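(* Let $n \geq 3$ be an integer, $R = \mathbb{Z}_n \times \mathbb{Z}_n$, and $m = \phi(n)$. Write $n = p_1^{k_1}p_2^{k_2}\cdots p_r^{k_r}$, where the $p_i$ ($1\le i\le r$) are distinct primes and each $k_i\ge 1$. Then: (1) If $4 \mid n$, then $UD(R)$ is the disjoint union of $m/2$ copies of $K_{m,m}$. (2) If $4 \nmid n$ and $4 \nmid (p_i - 1)$ for at least one of the odd primes $p_i$ in the prime factorization of $n$, then $UD(R)$ is the disjoint union of $m/2$ copies of $K_{m,m}$. (3) Suppose $4 \nmid n$ and $4 \mid (p_i - 1)$ for all the odd primes $p_i$ in the prime factorization of $n$. Case I: if $n$ is even, then $UD(R)$ is the disjoint union of $(m/2) - 2^{r-2}$ copies of $K_{m,m}$ and $2^{r-1}$ copies of $K_m$. Case II: if $n$ is odd, then $UD(R)$ is the disjoint union of $(m/2) - 2^{r-1}$ copies of $K_{m,m}$ and $2^r$ copies of $K_m$.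
   Context: $\mathbb{Z}_n$ is the ring of integers modulo $n$, $U(\cdot)$ denotes the group of units of a ring, and $\phi(n)=|U(\mathbb{Z}_n)|$ is Euler's totient function. For $R = \mathbb{Z}_n\times \mathbb{Z}_n$, the dot product of $x=(x_1,x_2)$ and $y=(y_1,y_2)$ is $x\cdot y = x_1y_1+x_2y_2\in \mathbb{Z}_n$. The unit dot product graph $UD(R)$ is the simple undirected graph with vertex set $U(R)=U(\mathbb{Z}_n)\times U(\mathbb{Z}_n)$, in which two distinct vertices $x,y$ are adjacent if and only if $x\cdot y=0$ in $\mathbb{Z}_n$. $K_m$ is the complete graph on $m$ vertices and $K_{m,m}$ the complete bipartite graph with parts of size $m$ and $m$. A graph is the disjoint union of given graphs if its vertex set is partitioned into subsets inducing (isomorphic copies of) those graphs, with no edges between vertices in different subsets. *)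

(* Defs.v *)
From HB Require Import structures.
From mathcomp Require Import all_boot all_order all_algebra.

Set Implicit Arguments.
Unset Strict Implicit.
Unset Printing Implicit Defensive.

Import GRing.Theory.

Record sgraph := SGraph {
  vertex :> finType;
  adj : rel vertex;
  adj_sym : symmetric adj;
  adj_irrefl : irreflexive adj
}.

Definition graph_iso (G H : sgraph) : Prop :=
  exists2 f : G -> H, bijective f & forall x y, adj (f x) (f y) = adj x y.

Section Induced.
Variables (G : sgraph) (A : {set G}).

Definition induced_adj : rel {x : G | x \in A} :=
  fun x y => adj (val x) (val y).

Fact induced_adj_sym : symmetric induced_adj.
Proof. by move=> x y; apply: adj_sym. Qed.

Fact induced_adj_irrefl : irreflexive induced_adj.
Proof. by move=> x; apply: adj_irrefl. Qed.

Definition induced : sgraph := SGraph induced_adj_sym induced_adj_irrefl.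

End Induced.

Definition disjoint_union_of (G : sgraph) (I : finType) (H : I -> sgraph)
    : Prop :=
  exists A : I -> {set G},
    [/\ forall x : G, exists i, x \in A i,
        forall i j, i != j -> [disjoint A i & A j],
        forall i j, i != j ->
          forall x y, x \in A i -> y \in A j -> ~~ adj x y
      & forall i, graph_iso (induced (A i)) (H i)].

Section Complete.
Variable m : nat.

Definition complete_adj : rel 'I_m := fun i j => i != j.

Fact complete_adj_sym : symmetric complete_adj.
Proof. by move=> i j; rewrite /complete_adj eq_sym. Qed.

Fact complete_adj_irrefl : irreflexive complete_adj.
Proof. by move=> i; rewrite /complete_adj eqxx. Qed.

Definition complete_graph : sgraph :=
  SGraph complete_adj_sym complete_adj_irrefl.

Definition complete_bip_adj : rel ('I_m + 'I_m)%type :=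
  fun u v => match u, v with
             | inl _, inr _ | inr _, inl _ => true
             | _, _ => false
             end.

Fact complete_bip_adj_sym : symmetric complete_bip_adj.
Proof. by case=> i; case=> j. Qed.

Fact complete_bip_adj_irrefl : irreflexive complete_bip_adj.
Proof. by case. Qed.

Definition complete_bip_graph : sgraph :=
  SGraph complete_bip_adj_sym complete_bip_adj_irrefl.

End Complete.

Notation "''K_' m" := (complete_graph m)
  (at level 8, m at level 2, format "''K_' m").
Notation "''KB_' m" := (complete_bip_graph m)
  (at level 8, m at level 2, format "''KB_' m").

Definition copies_Kmm_Km (a b m : nat) (i : 'I_a + 'I_b) : sgraph :=
  match i with
  | inl _ => 'KB_m
  | inr _ => 'K_m
  end.

Section UnitDotProductGraph.
Local Open Scope ring_scope.

Definition dot (A : comNzRingType) (x y : A * A) : A := x.1 * y.1 + x.2 * y.2.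

Variable A : finComUnitRingType.

Definition ud_adj : rel ({unit A} * {unit A})%type :=
  fun x y => (x != y) &&
             (dot (val x.1, val x.2) (val y.1, val y.2) == 0 :> A).

Fact ud_adj_sym : symmetric ud_adj.
Proof.
move=> x y; rewrite /ud_adj /dot eq_sym /=.
by rewrite (mulrC (val y.1)) (mulrC (val y.2)).
Qed.

Fact ud_adj_irrefl : irreflexive ud_adj.
Proof. by move=> x; rewrite /ud_adj eqxx. Qed.

(* This is the graph of the ring A * A, whose units are the pairs of units. *)
Definition UD : sgraph := SGraph ud_adj_sym ud_adj_irrefl.

End UnitDotProductGraph.

(* Main.v *)
Require Import Defs.
From HB Require Import structures.
From mathcomp Require Import all_boot all_order all_algebra.
From mathcomp Require Import fingroup cyclic finfield zify ring.

Set Implicit Arguments.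
Unset Strict Implicit.
Unset Printing Implicit Defensive.
Import GRing.Theory.

(** Sort the vertices (a, b) by their slope s = a / b, which runs over the units
    of Z_n. Since

      (s b) (t c) + b c = b c (s t + 1)

    and b c is a unit, two distinct vertices of slopes s and t are adjacent
    exactly when s t = -1, that is when t = sigma s for the map
    sigma s = - s^-1, regardless of b and c (adj_slope_pt). Each slope is
    carried by m = phi(n) vertices and sigma is an involution. A slope fixed by
    sigma gives m pairwise adjacent vertices, a copy of K_m; two distinct slopes
    exchanged by sigma give a copy of K_(m,m); there are no other edges. This
    holds over any finite commutative ring (UD_disjoint_union).

    With N fixed points there are N copies of K_m and (m - N) / 2 copies of
    K_(m,m), so it only remains to compute N, the number of square roots of -1
    modulo n. There is none modulo 4, nor modulo a prime p = 3 mod 4, hence none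
    modulo a multiple of one of these. Otherwise N is the product of its values
    at the prime powers dividing n, by the Chinese remainder theorem
    (card_sqrtN1_prod): it is 1 at 2, and 2 at the powers of a prime
    p = 1 mod 4 (card_sqrtN1_primepow). *)

(** * Square roots of -1 modulo n *)

Definition sqrtN1_mod (n : nat) : {set 'I_n} := [set x : 'I_n | n %| x ^ 2 + 1].

Lemma dvdn_sqrD1_mod (d x : nat) : (d %| (x %% d) ^ 2 + 1) = (d %| x ^ 2 + 1).
Proof. by rewrite /dvdn -modnDml modnXm modnDml. Qed.

Lemma sqrtN1_mod4 (x : nat) : ~~ (4 %| x ^ 2 + 1).
Proof.
rewrite -dvdn_sqrD1_mod.
by have := ltn_pmod x (isT : 0 < 4); case: (x %% 4) => [|[|[|[|]]]].
Qed.

(** If x ^ 2 = -1 modulo p then Fermat's theorem gives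
    1 = x ^ (p - 1) = (-1) ^ ((p - 1) / 2), so (p - 1) / 2 is even. *)
Lemma prime_dvd_sqrD1 (p x : nat) :
  prime p -> odd p -> p %| x ^ 2 + 1 -> 4 %| p - 1.
Proof.
move=> p_pr p_odd; have pF := pchar_Fp p_pr.
rewrite (dvdn_pcharf pF) natrD natrX addr_eq0 => /eqP x2.
have p_gt0 := prime_gt0 p_pr.
have x0 : (x%:R : 'F_p)%R != 0%R.
  apply/eqP => x0; move: x2; rewrite x0 expr0n /= => /esym/eqP.
  by rewrite oppr_eq0 oner_eq0.
have fermat : ((x%:R : 'F_p) ^+ (p - 1) = 1)%R.
  apply: (mulfI x0); rewrite -exprS mulr1.
  have -> : (p - 1).+1 = p by lia.
  by have := expf_card (x%:R : 'F_p)%R; rewrite card_Fp.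
have [h hE] : exists h, p - 1 = 2 * h by exists ((p - 1) %/ 2); lia.
rewrite hE exprM x2 -signr_odd in fermat; rewrite hE.
case h_odd: (odd _) fermat; last by move=> _; lia.
rewrite expr1 => /esym/eqP; rewrite -addr_eq0 -[X in (X + X)%R]/(1%:R)%R.
rewrite -natrD -(dvdn_pcharf pF) => p2.
by move: p2; rewrite dvdn_prime2 // => /eqP pE; rewrite pE in p_odd.
Qed.

(** The unit group of F_p is cyclic of order divisible by 4; the square of an
    element of order 4 has order 2, and -1 is the only such element of a
    field. *)
Lemma prime_sqrtN1_exists (p : nat) :
  prime p -> 4 %| p - 1 -> exists x, p %| x ^ 2 + 1.
Proof.
move=> p_pr /dvdnP[j pE]; have pF := pchar_Fp p_pr.
have p_gt1 := prime_gt1 p_pr.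
have [g gE] := cyclicP (field_unit_group_cyclic [set: {unit 'F_p}]%G).
have g_ord : #[g]%g = 4 * j.
  by rewrite orderE -gE card_finField_unit card_Fp //; lia.
exists (val (val g ^+ j)%R).
rewrite (dvdn_pcharf pF) natrD natrX.
have -> : ((val (val g ^+ j))%:R = val g ^+ j :> 'F_p)%R.
  exact: natr_Zp.
set y := (val g ^+ j)%R.
have y4 : (y ^+ 4 = 1)%R.
  by rewrite -exprM mulnC -g_ord -FinRing.val_unitX expg_order.
have y2 : (y ^+ 2 != 1)%R.
  rewrite -exprM -FinRing.val_unitX -[1%R]/(val (1%g : {unit 'F_p})).
  rewrite (inj_eq val_inj).
  rewrite -order_dvdn g_ord; apply/negP => /dvdn_leq; lia.
have : ((y ^+ 2 - 1) * (y ^+ 2 + 1) = 0)%R.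
  by rewrite -subr_sqr_1 -exprM y4 subrr.
by move/eqP; rewrite mulf_eq0 subr_eq0 (negPf y2).
Qed.

(** Newton's iteration for x ^ 2 + 1, started from a root modulo p. *)
Lemma primepow_sqrtN1_exists (p k : nat) :
  prime p -> 4 %| p - 1 -> exists x, p ^ k.+1 %| x ^ 2 + 1.
Proof.
move=> p_pr p1; elim: k => [|k [s sP]].
  by rewrite expn1; apply: prime_sqrtN1_exists.
have p_gt1 := prime_gt1 p_pr.
have [h hE] : exists h, p + 1 = 2 * h.
  by exists ((p + 1) %/ 2); lia.
(* Newton's step is s - (s ^ 2 + 1) / (2 s), where the division by 2 s is only
   needed modulo p: there -1 / s = s and h is the inverse of 2. *)
exists (s + (s ^ 2 + 1) * (s * h)).
have -> : (s + (s ^ 2 + 1) * (s * h)) ^ 2 + 1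
   = ((s ^ 2 + 1) * (1 + (s * h) ^ 2) + p * s ^ 2) * (s ^ 2 + 1).
  have -> : p * s ^ 2 = (2 * h - 1) * s ^ 2 by congr (_ * _); lia.
  case: h hE => [|h _]; first lia.
  have -> : 2 * h.+1 - 1 = 2 * h + 1 by lia.
  ring.
rewrite expnS; apply: dvdn_mul => //.
rewrite dvdn_addl ?dvdn_mulr //.
by apply: dvdn_trans sP; rewrite expnS dvdn_mulr.
Qed.

(** Let s be a root of x ^ 2 = -1 modulo q = p ^ k. Any root x satisfies
    q %| (x - s) (x + s). The prime p cannot divide both factors, as it would
    divide 2 x and hence 1; so q divides one of them, and x is s or -s. *)
Lemma card_sqrtN1_primepow (p k : nat) :
  prime p -> 4 %| p - 1 -> 1 <= k -> #|sqrtN1_mod (p ^ k)| = 2.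
Proof.
move=> p_pr p1; case: k => // k _.
have p_gt1 := prime_gt1 p_pr.
have [s0] := primepow_sqrtN1_exists k p_pr p1.
rewrite -dvdn_sqrD1_mod.
have q_odd : odd (p ^ k.+1) by rewrite oddX; apply/orP; right; lia.
have p_q : p %| p ^ k.+1 by rewrite expnS dvdn_mulr.
have pX y : coprime p y -> coprime (p ^ k.+1) y by move=> ?; rewrite coprimeXl.
have q_gt1 : 1 < p ^ k.+1 by rewrite -(exp1n k.+1) ltn_exp2r.
move: (p ^ k.+1) q_odd p_q pX q_gt1 => q q_odd p_q pX q_gt1.
have := ltn_pmod s0 (ltnW q_gt1); move: (s0 %% q) => s s_lt sP.
have s_gt0 : 0 < s.
  by case: s sP {s_lt} => //; rewrite exp0n // add0n dvdn1 => /eqP; lia.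
have t_lt : q - s < q by lia.
have <- : [set Ordinal s_lt; Ordinal t_lt] = sqrtN1_mod q; last first.
  rewrite cards2; case: eqP => // /(congr1 val) /=; lia.
suff mem x : x < q -> (q %| x ^ 2 + 1) = (x == s) || (x == q - s).
  by apply/setP => x; rewrite !inE -!val_eqE /= mem.
move=> x_lt.
(* Modulo q this is (y + s) (y - s) = (y ^ 2 + 1) - (s ^ 2 + 1), with q - s
   standing for - s in nat. *)
have conj y : (y + s) * (y + (q - s)) + (s ^ 2 + 1) = y ^ 2 + 1 + q * (y + s).
  by rewrite -{2}(subnKC (ltnW s_lt)); ring.
have q_dvd y : (q %| (y + s) * (y + (q - s))) = (q %| y ^ 2 + 1).
  by rewrite -(dvdn_addl _ sP) conj dvdn_addl // dvdn_mulr.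
have q_eq z : 0 < z -> z < 2 * q -> q %| z -> z = q.
  move=> z_gt0 z_lt /dvdnP[[|[|c]] zE]; rewrite zE in z_gt0 z_lt *;
    rewrite ?mul1n //.
  by move: z_lt; rewrite ltn_pmul2r ?(ltnW q_gt1).
apply/idP/idP => [xP|/orP[] /eqP-> //]; last first.
  by rewrite -q_dvd subnK ?(ltnW s_lt) // dvdn_mulr.
have q_prod : q %| (x + s) * (x + (q - s)) by rewrite q_dvd.
have [p_xs|] := boolP (p %| x + s); last first.
  rewrite -prime_coprime // => /pX q_co; move: q_prod.
  by rewrite Gauss_dvdr // => /q_eq eq_q; apply/orP; left; lia.
have [p_xt|] := boolP (p %| x + (q - s)); last first.
  rewrite -prime_coprime // => /pX q_co; move: q_prod.
  by rewrite Gauss_dvdl // => /q_eq eq_q; apply/orP; right; lia.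
have : p %| 2 * x.
  rewrite -(dvdn_addl _ p_q).
  have -> : 2 * x + q = x + s + (x + (q - s)) by lia.
  by rewrite dvdn_addl.
rewrite Euclid_dvdM // dvdn_prime2 // => /orP[/eqP pE|p_x].
  by rewrite pE in p1.
have := dvdn_trans p_q xP.
by rewrite dvdn_addr ?(dvdn_mulr, expnS) // dvdn1 => /eqP; lia.
Qed.

Lemma card_sqrtN1_mod2 : #|sqrtN1_mod (2 ^ 1)| = 1.
Proof.
have -> : sqrtN1_mod (2 ^ 1) = [set ord_max].
  by apply/setP => x; rewrite !inE -val_eqE; case: x => [[|[|]]].
exact: cards1.
Qed.

(** The Chinese remainder bijection x |-> (x %% a, x %% b) sends the roots
    modulo a * b onto the pairs of roots modulo a and b. *)
Lemma card_sqrtN1_coprime (a b : nat) : 0 < a -> 0 < b -> coprime a b ->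
  #|sqrtN1_mod (a * b)| = #|sqrtN1_mod a| * #|sqrtN1_mod b|.
Proof.
move=> a_gt0 b_gt0 ab_co.
pose f (x : 'I_(a * b)) :=
  (Ordinal (ltn_pmod x a_gt0), Ordinal (ltn_pmod x b_gt0)).
rewrite -cardsX -(card_in_imset (f := f)); last first.
  move=> x y _ _ [xy_a xy_b]; apply: val_inj.
  have /eqP : x == y %[mod a * b].
    by rewrite (chinese_remainder ab_co) xy_a xy_b !eqxx.
  by rewrite !modn_small.
congr #|pred_of_set _|; apply/setP => -[u v]; rewrite !inE /=.
apply/imsetP/andP => [[x] | [uP vP]].
  rewrite inE Gauss_dvd // => /andP[xa xb] [-> ->] /=.
  by rewrite !dvdn_sqrD1_mod.
have ab_gt0 : 0 < a * b by rewrite muln_gt0 a_gt0.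
pose x := chinese a b u v %% (a * b).
have xu : x %% a = u.
  by rewrite modn_dvdm ?dvdn_mulr // chinese_modl // modn_small.
have xv : x %% b = v.
  by rewrite modn_dvdm ?dvdn_mull // chinese_modr // modn_small.
exists (Ordinal (ltn_pmod (chinese a b u v) ab_gt0)).
  rewrite inE Gauss_dvd //= -/x -[a %| _]dvdn_sqrD1_mod.
  by rewrite -[b %| _]dvdn_sqrD1_mod xu xv uP.
by congr (_, _); apply: val_inj; rewrite /= -/x.
Qed.

Lemma card_sqrtN1_prod (I : finType) (q : I -> nat) :
    (forall i, 0 < q i) -> (forall i j, i != j -> coprime (q i) (q j)) ->
  #|sqrtN1_mod (\prod_i q i)| = \prod_i #|sqrtN1_mod (q i)|.
Proof.
move=> q_gt0 q_co.
elim: (index_enum I) (index_enum_uniq I) => [_|i e IHe /= /andP[i_e e_uniq]].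
  rewrite !big_nil (_ : sqrtN1_mod 1 = setT) ?cardsT ?card_ord //.
  by apply/setP => x; rewrite !inE dvd1n.
rewrite !big_cons card_sqrtN1_coprime ?IHe ?prodn_gt0 //.
rewrite big_seq; elim/big_rec: _ => [|j y j_e]; first exact: coprimen1.
by rewrite coprimeMr => ->; rewrite q_co //; apply: contraNneq i_e => ->.
Qed.

(** A square root of -1 is automatically a unit, with inverse its opposite. *)
Lemma card_unit_sqrtN1 (n : nat) : 1 < n ->
  #|[set s : {unit 'Z_n} | (val s * val s == -1)%R]| = #|sqrtN1_mod n|.
Proof.
case: n => [|[|n]] // _.
rewrite -(card_imset _ val_inj); apply: eq_card => x; rewrite !inE.
have xP : (x * x == -1)%R = (n.+2 %| x ^ 2 + 1).
  rewrite -addr_eq0 -[in LHS](natr_Zp x) -natrM natr1.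
  by rewrite -(inj_eq val_inj) /= val_Zp_nat // mulnn addn1.
rewrite -xP; apply/imsetP/eqP => [[s]|x2]; first by rewrite inE => /eqP ? ->.
have xU : (x \is a GRing.unit)%R.
  by apply/unitrP; exists (- x)%R; rewrite mulrN mulNr x2 opprK.
by exists (FinRing.unit 'Z_n.+2 xU); rewrite ?inE /= ?x2.
Qed.

(** * Disjoint unions of graphs *)

Lemma embedding_iso (G H : sgraph) (g : H -> G) : injective g ->
  (forall u v, adj (g u) (g v) = adj u v) ->
  graph_iso (induced [set g u | u in [set: H]]) H.
Proof.
move=> g_inj g_adj.
have ex (x : induced [set g u | u in [set: H]]) : exists u, g u == val x.
  by have /imsetP[u _ ->] := valP x; exists u.
pose f x := xchoose (ex x).
have gf x : g (f x) = val x by apply/eqP/(xchooseP (ex x)).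
have g_in u : g u \in [set g u | u in [set: H]] by apply: imset_f.
exists f; last by move=> x y; rewrite -g_adj !gf.
exists (fun u => Sub (g u) (g_in u)).
  by move=> x; apply: val_inj; rewrite SubK gf.
by move=> u; apply: g_inj; rewrite gf SubK.
Qed.

(** It is easier to parametrize the pieces than to describe the subsets of
    vertices that they occupy and then identify the induced subgraphs. *)
Lemma disjoint_union_of_embeddings (G : sgraph) (I : finType)
    (H : I -> sgraph) (g : forall i, H i -> G) :
    (forall x, exists i u, g i u = x) ->
    (forall i j u v, g i u = g j v -> i = j) ->
    (forall i, injective (g i)) ->
    (forall i u v, adj (g i u) (g i v) = adj u v) ->
    (forall i j u v, i != j -> ~~ adj (g i u) (g j v)) ->
  disjoint_union_of G H.
Proof.
move=> g_cov g_idx g_inj g_adj g_nadj.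
exists (fun i => [set g i u | u in [set: H i]]); split=> [x|i j|i j ij x y|i].
- by have [i [u <-]] := g_cov x; exists i; apply: imset_f.
- apply: contraNT => /pred0Pn[x /andP[/= /imsetP[u _ ->] /imsetP[v _ uv]]].
  exact/eqP/(g_idx _ _ _ _ uv).
- by move=> /imsetP[u _ ->] /imsetP[v _ ->]; apply: g_nadj.
- exact: embedding_iso.
Qed.

(** Reindexing serves to drop an empty family of copies of K_m. *)
Lemma disjoint_union_of_bij (G : sgraph) (I J : finType) (h : J -> I)
    (H : I -> sgraph) : bijective h ->
  disjoint_union_of G H -> disjoint_union_of G (H \o h).
Proof.
move=> [k hK kK] [A [A_cov A_disj A_nadj A_iso]].
have h_neq i j : i != j -> h i != h j by rewrite (can_eq hK).
exists (A \o h); split=> [x|i j ij|i j ij|i] /=.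
- by have [i xi] := A_cov x; exists (k i); rewrite /= kK.
- exact/A_disj/h_neq.
- exact/A_nadj/h_neq.
- exact: A_iso.
Qed.

(** * Orbits of an involution *)

Section Involution.
Variables (T : finType) (f : T -> T).

(** Comparing positions in the enumeration of T selects one point from each
    pair {x, f x} with x != f x; the f-image of this set is then the other half
    of the points moved by f. *)
Definition two_cycle_reps : {set T} := [set x | enum_rank x < enum_rank (f x)].

Lemma card_two_cycle_reps : involutive f ->
  #|T| = 2 * #|two_cycle_reps| + #|[set x | f x == x]|.
Proof.
move=> fK.
have im_reps : f @: two_cycle_reps = [set x | enum_rank (f x) < enum_rank x].
  apply/setP => x; rewrite inE; apply/imsetP/idP => [[y]|xP].
    by rewrite inE => ? ->; rewrite fK.
  by exists (f x); rewrite ?inE fK.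
rewrite mul2n -addnn -{2}(card_imset _ (inv_inj fK)) im_reps.
transitivity #|[set: T]|; first by rewrite cardsT.
rewrite -(cardsID [set x | f x == x] setT) addnC setTI setTD.
congr (_ + _); rewrite -(cardsID two_cycle_reps (~: _)); congr (_ + _).
  apply: eq_card => x; rewrite !inE -(inj_eq enum_rank_inj) -val_eqE /=.
  by case: ltngtP.
apply: eq_card => x; rewrite !inE -(inj_eq enum_rank_inj) -val_eqE /=.
by case: ltngtP.
Qed.

Lemma two_cycle_repsP x : involutive f ->
  [\/ x \in two_cycle_reps, f x \in two_cycle_reps | f x = x].
Proof.
move=> fK; rewrite !inE fK.
case: ltngtP => [_|_|/val_inj/enum_rank_inj/esym fx].
- by constructor 1.
- by constructor 2.
- by constructor 3.
Qed.

Lemma two_cycle_reps_notin x : involutive f ->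
  x \in two_cycle_reps -> f x \notin two_cycle_reps.
Proof. by move=> fK; rewrite !inE fK -leqNgt => /ltnW. Qed.

Lemma two_cycle_reps_neq x : x \in two_cycle_reps -> f x != x.
Proof. by rewrite inE; apply: contraTneq => ->; rewrite ltnn. Qed.

End Involution.

(** * The unit dot product graph of a finite commutative ring *)

Section UnitDot.
Variable A : finComUnitRingType.
Local Notation U := {unit A}.

Definition unitN1 : U := FinRing.unit A (unitrN1 A).

Definition neg_inv (s : U) : U := (unitN1 * s^-1)%g.

Lemma unit_mulgC (s t : U) : (s * t = t * s)%g.
Proof. by apply: val_inj; rewrite /= mulrC. Qed.

(** Orthogonality of the directions (s, 1) and (t, 1), solved for t. *)
Lemma neg_invE (s t : U) : (val s * val t == -1)%R = (t == neg_inv s).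
Proof.
rewrite -[(val s * val t)%R]/(val (s * t)%g) -[(-1)%R]/(val unitN1).
rewrite (inj_eq val_inj) /neg_inv -(inj_eq (mulIg s) t) mulgKV unit_mulgC.
by [].
Qed.

Lemma neg_invK : involutive neg_inv.
Proof.
by move=> s; apply/esym/eqP; rewrite -neg_invE mulrC neg_invE.
Qed.

(** Coordinates on the vertices: the slope and the second component. *)
Definition slope_pt (s b : U) : UD A := ((s * b)%g, b).

Lemma slope_pt_surj (x : UD A) : exists s b, slope_pt s b = x.
Proof. by case: x => a b; exists (a * b^-1)%g, b; rewrite /slope_pt mulgKV. Qed.

Lemma slope_pt_inj s t b c : slope_pt s b = slope_pt t c -> s = t /\ b = c.
Proof.
move=> eq_pt; have bc : b = c := congr1 snd eq_pt.
by split=> //; have := congr1 fst eq_pt; rewrite /= bc => /mulIg.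
Qed.

(** The dot product of the two points is b c (s t + 1), where b c is a unit;
    adjacency thus depends on the slopes only, apart from the loops. *)
Lemma adj_slope_pt s t b c :
  adj (slope_pt s b) (slope_pt t c) = ((s, b) != (t, c)) && (t == neg_inv s).
Proof.
rewrite /= /ud_adj -neg_invE; congr (~~ _ && _).
  apply/eqP/eqP => [/slope_pt_inj[-> ->] //|[-> ->] //].
rewrite /dot /=.
have -> : (val s * val b * (val t * val c) + val b * val c
  = val b * val c * (val s * val t + 1))%R.
  by rewrite mulrDr mulr1 mulrACA mulrC.
have bc_unit : (val b * val c \is a GRing.unit)%R.
  by rewrite unitrM (valP b) (valP c).
by rewrite -addr_eq0 -[RHS](inj_eq (mulrI bc_unit)) mulr0.
Qed.

(** The two sides of a copy of K_(m,m) are the points of slope s and those of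
    slope neg_inv s, for s a representative of a 2-cycle of neg_inv; a copy of
    K_m is the set of points whose slope is a given fixed point. *)
Lemma UD_disjoint_union (a b m : nat) :
    #|{: U}| = m -> #|two_cycle_reps neg_inv| = a ->
    #|[set s | neg_inv s == s]| = b ->
  disjoint_union_of (UD A) (@copies_Kmm_Km a b m).
Proof.
move=> <- <- <-.
set R := two_cycle_reps _; set F := [set s | _].
pose slope (i : 'I_#|R| + 'I_#|F|) (u : copies_Kmm_Km #|{: U}| i) : U :=
  match i return copies_Kmm_Km #|{: U}| i -> U with
  | inl i => fun u => if u is inl _ then enum_val i else neg_inv (enum_val i)
  | inr i => fun _ => enum_val i
  end u.
pose base (i : 'I_#|R| + 'I_#|F|) (u : copies_Kmm_Km #|{: U}| i) : U :=
  match i return copies_Kmm_Km #|{: U}| i -> U with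
  | inl i => fun u => match u with inl j | inr j => enum_val j end
  | inr i => fun j => enum_val j
  end u.
have R_in (i : 'I_#|R|) : enum_val i \in R by apply: enum_valP.
have R_neq (i : 'I_#|R|) : neg_inv (enum_val i) != enum_val i.
  exact: two_cycle_reps_neq.
have RR x y : x \in R -> y \in R -> x <> neg_inv y.
  move=> xR yR xy; have := two_cycle_reps_notin neg_invK yR.
  by rewrite -xy xR.
have RF x y : x \in R -> neg_inv y = y -> x <> y.
  by move=> xR yF xy; have := two_cycle_reps_neq xR; rewrite xy yF eqxx.
have F_fix (i : 'I_#|F|) : neg_inv (enum_val i) = enum_val i.
  by have := enum_valP i; rewrite inE => /eqP.
have slope_idx i j u v : slope i u = slope j v -> i = j.
  move: i j u v => [i|i] [j|j] /=.
  - move=> [u|u] [v|v] /=.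
    + by move/enum_val_inj->.
    + by move/RR; case.
    + by move/esym/RR; case.
    + by move/(inv_inj neg_invK)/enum_val_inj->.
  - move=> [u|u] v /=; first by move/RF; case.
    by rewrite -F_fix => /(inv_inj neg_invK)/RF; case.
  - move=> u [v|v] /= /esym; first by move/RF; case.
    by rewrite -F_fix => /(inv_inj neg_invK)/RF; case.
  - by move=> _ _ /enum_val_inj->.
(* The slopes of each piece are stable under neg_inv, so no edge leaves it. *)
have slope_neg i u : exists v, neg_inv (slope i u) = slope i v.
  case: i u => [i [u|u]|i u] /=; [exists (inr u)|exists (inl u)|exists u] => //.
    exact: neg_invK.
pose g i u := slope_pt (slope i u) (base i u).
apply: (disjoint_union_of_embeddings (g := g)).
- move=> x; have [s [c <-]] := slope_pt_surj x.
  pose j := enum_rank c; have jE : enum_val j = c by exact: enum_rankK.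
  have [sR|sR|sF] := two_cycle_repsP s neg_invK.
  + exists (inl (enum_rank_in sR s)), (inl j).
    by rewrite /g /= jE enum_rankK_in.
  + exists (inl (enum_rank_in sR (neg_inv s))), (inr j).
    by rewrite /g /= jE enum_rankK_in // neg_invK.
  + have sF' : s \in F by rewrite inE sF.
    exists (inr (enum_rank_in sF' s)), j.
    by rewrite /g /= jE enum_rankK_in.
- by move=> i j u v /slope_pt_inj[/slope_idx].
- move=> i u v /slope_pt_inj[].
  case: i u v => [i [u|u] [v|v]|i u v] //=.
  + by move=> _ /enum_val_inj->.
  + by move/eqP; rewrite eq_sym (negPf (R_neq i)).
  + by move/eqP; rewrite (negPf (R_neq i)).
  + by move=> _ /enum_val_inj->.
  + by move=> _ /enum_val_inj->.
- move=> i u v; rewrite adj_slope_pt xpair_eqE.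
  case: i u v => [i [u|u] [v|v]|i u v] /=.
  + by rewrite [_ == neg_inv _]eq_sym (negPf (R_neq i)) andbF.
  + by rewrite eqxx eq_sym (negPf (R_neq i)).
  + by rewrite neg_invK eqxx (negPf (R_neq i)).
  + by rewrite neg_invK (negPf (R_neq i)) andbF.
  + by rewrite F_fix !eqxx andbT (inj_eq enum_val_inj).
- move=> i j u v; apply: contra; rewrite adj_slope_pt => /andP[_ /eqP].
  by have [w ->] := slope_neg i u => /slope_idx->.
Qed.

End UnitDot.

(** * The unit dot product graph of Z_n *)

Lemma UD_Zn_disjoint_union (n : nat) : 1 < n ->
  disjoint_union_of (UD 'Z_n)
    (@copies_Kmm_Km ((totient n - #|sqrtN1_mod n|) %/ 2) #|sqrtN1_mod n|
       (totient n)).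
Proof.
move=> n_gt1.
have fixE : #|[set s : {unit 'Z_n} | neg_inv s == s]| = #|sqrtN1_mod n|.
  rewrite -card_unit_sqrtN1 //; apply: eq_card => s.
  by rewrite !inE neg_invE eq_sym.
have unitE : #|{: {unit 'Z_n}}| = totient n.
  by rewrite -cardsT -card_units_Zp // ltnW.
apply: UD_disjoint_union => //.
have := card_two_cycle_reps (@neg_invK 'Z_n).
by rewrite fixE unitE => ->; rewrite addnK mulKn.
Qed.

Lemma UD_Zn_bipartite (n : nat) : 1 < n -> (forall x, ~~ (n %| x ^ 2 + 1)) ->
  disjoint_union_of (UD 'Z_n) (fun _ : 'I_(totient n %/ 2) => 'KB_(totient n)).
Proof.
move=> n_gt1 n_ndvd.
have N0 : #|sqrtN1_mod n| = 0.
  by apply: eq_card0 => x; rewrite inE (negPf (n_ndvd x)).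
have := UD_Zn_disjoint_union n_gt1; rewrite N0 subn0.
apply: (disjoint_union_of_bij (h := inl)).
apply: inj_card_bij => [i j [] //|].
by rewrite card_sum !card_ord addn0.
Qed.

Theorem theorem3p2 (n m r : nat) (p k : 'I_r -> nat)
    (n_ge3 : 3 <= n) (m_def : m = totient n)
    (p_prime : forall i, prime (p i)) (p_inj : injective p)
    (k_ge1 : forall i, 1 <= k i)
    (n_fact : n = \prod_(i < r) p i ^ k i) :
  [/\ 4 %| n ->
        disjoint_union_of (UD 'Z_n) (fun _ : 'I_(m %/ 2) => 'KB_m),
      ~~ (4 %| n) -> (exists i, odd (p i) /\ ~~ (4 %| p i - 1)) ->
        disjoint_union_of (UD 'Z_n) (fun _ : 'I_(m %/ 2) => 'KB_m)
    & ~~ (4 %| n) -> (forall i, odd (p i) -> 4 %| p i - 1) ->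
        (~~ odd n ->
           disjoint_union_of (UD 'Z_n)
             (@copies_Kmm_Km (m %/ 2 - 2 ^ (r - 2)) (2 ^ (r - 1)) m))
        /\
        (odd n ->
           disjoint_union_of (UD 'Z_n)
             (@copies_Kmm_Km (m %/ 2 - 2 ^ (r - 1)) (2 ^ r) m))].
Proof.
have n_gt1 : 1 < n by apply: ltnW.
have p_dvd i : p i %| n.
  rewrite n_fact (bigD1 i) //= dvdn_mulr //.
  by rewrite -(prednK (k_ge1 i)) expnS dvdn_mulr.
have cop i j : i != j -> coprime (p i ^ k i) (p j ^ k j).
  move=> ij; rewrite coprimeXl // coprimeXr // prime_coprime // dvdn_prime2 //.
  by apply: contra ij => /eqP/p_inj->.
have N_prod : #|sqrtN1_mod n| = \prod_i #|sqrtN1_mod (p i ^ k i)|.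
  by rewrite n_fact card_sqrtN1_prod // => i; rewrite expn_gt0 prime_gt0.
have := UD_Zn_disjoint_union n_gt1; rewrite -m_def => UDn.
split.
- move=> n4; rewrite m_def; apply: UD_Zn_bipartite => // x.
  by apply: contra (sqrtN1_mod4 x); apply: dvdn_trans.
- move=> _ [i [p_odd p1]]; rewrite m_def; apply: UD_Zn_bipartite => // x.
  apply: contra p1 => /(dvdn_trans (p_dvd i)).
  exact: prime_dvd_sqrD1.
move=> n4 p1; have N2 i : odd (p i) -> #|sqrtN1_mod (p i ^ k i)| = 2.
  by move=> p_odd; rewrite card_sqrtN1_primepow ?p1.
split=> n_odd; last first.
  have NE : #|sqrtN1_mod n| = 2 ^ r.
    rewrite N_prod (eq_bigr (fun=> 2)); last first.
      by move=> i _; apply/N2/(dvdn_odd (p_dvd i)).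
    by rewrite prod_nat_const card_ord.
  have r_gt0 : 0 < r.
    case: r p k {p_prime p_inj k_ge1 p_dvd cop N_prod p1 N2 NE UDn} n_fact
      => //.
    by move=> p k; rewrite big_ord0 => n1; rewrite n1 in n_gt1.
  have -> : m %/ 2 - 2 ^ (r - 1) = (m - #|sqrtN1_mod n|) %/ 2.
    rewrite NE; have {2}-> : r = (r - 1).+1 by lia.
    by rewrite expnS; lia.
  by rewrite -NE.
have [i0 p2] : exists i, p i = 2.
  have : 2 %| n by rewrite dvdn2.
  rewrite n_fact Euclid_dvd_prod // big_has => /hasP[i _].
  by rewrite Euclid_dvdX // dvdn_prime2 // => /andP[/eqP p2 _]; exists i.
have k1 : k i0 = 1.
  case kE: (k i0) (k_ge1 i0) => [|[|c]] // _; case/negP: n4.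
  rewrite n_fact (bigD1 i0) //= p2 kE dvdn_mulr //.
  by rewrite (dvdn_exp2l 2 (isT : 2 <= c.+2)).
have p_odd i : i != i0 -> odd (p i).
  move=> i_neq; apply: contraNT i_neq; rewrite -dvdn2 dvdn_prime2 // -p2.
  by move/eqP/p_inj->.
have NE : #|sqrtN1_mod n| = 2 ^ (r - 1).
  rewrite N_prod (bigD1 i0) //= p2 k1 card_sqrtN1_mod2 mul1n.
  rewrite (eq_bigr (fun=> 2)); last by move=> i i_neq; apply/N2/p_odd.
  by rewrite prod_nat_const cardC1 card_ord subn1.
(* With a single prime factor n would be 2; the exponent r - 2 below is not
   truncated. *)
have r_ge2 : 1 < r.
  rewrite ltnNge; apply/negP => r_le1.
  have : #|predC1 i0| = 0 by rewrite cardC1 card_ord; lia.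
  move/card0_eq => no_i; move: n_ge3.
  by rewrite n_fact (bigD1 i0) //= p2 k1 big_pred0.
have -> : m %/ 2 - 2 ^ (r - 2) = (m - #|sqrtN1_mod n|) %/ 2.
  rewrite NE; have -> : r - 1 = (r - 2).+1 by lia.
  by rewrite expnS; lia.
by rewrite -NE.
Qed.
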